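(* Assume projective determinacy (PD). For each $n\in\omega$, there is a wRK-complete $\mathbf{\Pi}^1_{2n+1}$ ideal on $\omega$; that is, there is a $\mathbf{\Pi}^1_{2n+1}$ ideal $\mathcal J$ on $\omega$ such that $\mathcal I \leq_{\rm wRK} \mathcal J$ for every $\mathbf{\Pi}^1_{2n+1}$ ideal $\mathcal I$ on $\omega$.
   Context: PD is the assertion that every two-player perfect-information game of length $\omega$ on $\omega$ with projective payoff set is determined. The power set $\mathcal P(\omega)$ is identified with the Cantor space $2^\omega$ via characteristic functions. An ideal on $\omega$ is a nonempty family $\mathcal I$ of subsets of $\omega$ such that for all $x,y\subseteq\omega$: $x,y\in\mathcal I \implies x\cup y\in\mathcal I$, and $y\subseteq x\in\mathcal I \implies y\in\mathcal I$. (An ideal need not contain all finite sets and may equal $2^\omega$.) An ideal is called $\mathbf{\Pi}^1_{2n+1}$ if it is a (boldface) $\mathbf{\Pi}^1_{2n+1}$ subset of $2^\omega$. For ideals $\mathcal I,\mathcal J$ on $\omega$, $\mathcal I\leq_{\rm wRK}\mathcal J$ (weak Rudin-Keisler reducibility) means that there are an infinite set $A\subseteq\omega$ and a function $f:A\to\omega$ such that for each $x\subseteq\omega$, $x\in\mathcal I \iff f^{-1}[x]\in\mathcal J$, where $f^{-1}[x]=\{a\in A: f(a)\in x\}$. If $\mathcal C$ is a family of ideals and $\mathcal J\in\mathcal C$ satisfies $\mathcal I\leq_{\rm wRK}\mathcal J$ for each $\mathcal I\in\mathcal C$, then $\mathcal J$ is called a wRK-complete $\mathcal C$ ideal. *)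

(* Defs.v *)
From mathcomp Require Import all_boot all_order all_algebra.
From mathcomp Require Import all_classical all_reals all_analysis.

Set Implicit Arguments.
Unset Strict Implicit.
Unset Printing Implicit Defensive.

Local Open Scope classical_set_scope.

Notation baire_space := {ptws nat -> nat}.

(* [Sigma1 n A]: A is boldface Sigma^1_n in X.  Sigma^1_1 sets are the
   projections along the Baire space of closed sets, Sigma^1_{n+1} sets those
   of Pi^1_n sets, for n >= 1.  The classes of index 0 are left empty. *)
Fixpoint Sigma1 (n : nat) (X : topologicalType) (A : set X) {struct n} : Prop :=
  if n is m.+1 then
    exists2 B : set (X * baire_space),
      (if m is 0 then closed B else Sigma1 m (~` B)) & A = fst @` B
  else False.

Definition Pi1 (n : nat) (X : topologicalType) (A : set X) : Prop :=
  Sigma1 n (~` A).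

Definition projective (X : topologicalType) (A : set X) : Prop :=
  exists n, Sigma1 n A.

(* Games of length omega on omega: player I chooses x 0, x 2, ..., player II
   chooses x 1, x 3, ..., and I wins iff x belongs to the payoff set.
   A strategy maps finite positions to moves; only its values at positions
   where its owner is to move matter. *)
Definition strategy := seq nat -> nat.

Definition follows (player : bool) (s : strategy) (x : baire_space) : Prop :=
  forall k, odd k = player -> x k = s (mkseq x k).

Definition winning_I (A : set baire_space) (s : strategy) : Prop :=
  forall x, follows false s x -> A x.

Definition winning_II (A : set baire_space) (s : strategy) : Prop :=
  forall x, follows true s x -> ~ A x.

Definition determined (A : set baire_space) : Prop :=
  (exists s, winning_I A s) \/ (exists s, winning_II A s).

Definition PD : Prop :=
  forall A : set baire_space, projective A -> determined A.

(* Neither properness nor containing the finite sets is required. *)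
Definition ideal (I : set (set nat)) : Prop :=
  [/\ I !=set0,
      forall x y, I x -> I y -> I (x `|` y)
    & forall x y, y `<=` x -> I x -> I y].

(* The subset of 2^omega that a family of subsets of omega becomes when x is
   identified with its characteristic function. *)
Definition char_family (I : set (set nat)) : set cantor_space :=
  [set c : cantor_space | I [set k | c k = true]].

Definition Pi1_ideal (n : nat) : set (set (set nat)) :=
  [set I | ideal I /\ Pi1 n (char_family I)].

(* The values of f outside A are irrelevant: f stands for a map A -> omega and
   A `&` f @^-1` x is the preimage of x under that map. *)
Definition le_wRK (I J : set (set nat)) : Prop :=
  exists (A : set nat) (f : nat -> nat),
    infinite_set A /\ forall x : set nat, I x <-> J (A `&` f @^-1` x).

Definition wRK_complete (C : set (set (set nat))) (J : set (set nat)) : Prop :=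
  C J /\ forall I, C I -> le_wRK I J.

(* Main.v *)
(* A Pi^1_{2n+1} norm on a universal Pi^1_{2n+1} set U, in the form of a
   relation S that compares ranks strictly, turns each section U_z into an
   ideal G_z, which is U_z itself if U_z was an ideal already: x is in G_z iff
   no finite chain starting at x leaves U_z, where x' may follow x if x' is
   contained in y `|` y' for some y, y' that S does not place above x.  The
   chains exist in a Sigma^1_{2n+1} way, and two members of G_z are comparable,
   so their union follows one of them.  The ideals G_z are then spread over the
   branches z of the tree of finite sequences.  Two branches share only finitely
   many nodes, so that G_z is recovered on the branch z, without assuming that
   it contains the finite sets, by letting infinitely many nodes stand for each
   natural number.

   The norm comes from the first periodicity theorem of Martin and Moschovakis.
   What is carried through the induction is a pair of relations L (at most) and
   S (below) without an infinite descent, which is the only property of norms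
   that is needed; no ordinals occur. *)
Require Import Defs.
From mathcomp Require Import all_boot all_classical.
From mathcomp Require Import topology cantor.

Set Implicit Arguments.
Unset Strict Implicit.
Unset Printing Implicit Defensive.

Local Open Scope classical_set_scope.
Local Notation N := (nat -> nat).

(** * The projective hierarchy on sequences, with interleaving as pairing *)

Definition jn (x y : N) : N := fun k => if odd k then y k./2 else x k./2.
Definition ev (u : N) : N := fun k => u k.*2.
Definition od (u : N) : N := fun k => u k.*2.+1.

Lemma evE x y : ev (jn x y) = x.
Proof. by apply/funext => k; rewrite /ev /jn odd_double doubleK. Qed.

Lemma odE x y : od (jn x y) = y.
Proof.
by apply/funext => k; rewrite /od /jn /= odd_double /= uphalf_double.
Qed.

Lemma jnK u : jn (ev u) (od u) = u.
Proof.
apply/funext => k; rewrite /jn /ev /od; have := odd_double_half k.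
by case: (odd k) => /= {2}<-.
Qed.

Definition agree (m : nat) (x y : N) := forall i, i < m -> x i = y i.

Lemma agree_le m k x y : k <= m -> agree m x y -> agree k x y.
Proof. by move=> km xy i ik; apply: xy; apply: leq_trans km. Qed.

Lemma agree_sym m x y : agree m x y -> agree m y x.
Proof. by move=> xy i /xy. Qed.

Lemma agree_trans m x y z : agree m x y -> agree m y z -> agree m x z.
Proof. by move=> xy yz i im; rewrite xy // yz. Qed.

Lemma agree_mkseq m x y : agree m x y -> mkseq x m = mkseq y m.
Proof.
by move=> xy; apply/eq_in_map => i; rewrite mem_iota add0n => /andP[_ /xy].
Qed.

Lemma mkseq_agree m x y : mkseq x m = mkseq y m -> agree m x y.
Proof.
by move=> xy i im; rewrite -(nth_mkseq 0 x im) xy nth_mkseq.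
Qed.

Definition cts (F : N -> N) :=
  forall x k, exists m, forall y, agree m x y -> agree k (F x) (F y).

Lemma cts_pointwise F :
  (forall x k, exists m, forall y, agree m x y -> F x k = F y k) -> cts F.
Proof.
move=> cF x; elim=> [|k [m mP]]; first by exists 0.
have [m' m'P] := cF x k; exists (maxn m m') => y xy i.
rewrite ltnS leq_eqVlt => /orP[/eqP->|ik].
  by apply: m'P; apply: agree_le xy; rewrite leq_maxr.
by apply: mP ik; apply: agree_le xy; rewrite leq_maxl.
Qed.

Lemma cts_id : cts id.
Proof. by move=> x k; exists k. Qed.

Lemma cts_cst c : cts (fun=> c).
Proof. by move=> x k; exists 0. Qed.

Lemma cts_comp F G : cts F -> cts G -> cts (fun u => F (G u)).
Proof.
move=> cF cG x k; have [m mP] := cF (G x) k; have [l lP] := cG x m.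
by exists l => y /lP /mP.
Qed.

Lemma cts_ev F : cts F -> cts (fun u => ev (F u)).
Proof.
apply: cts_comp => x k; exists k.*2 => y xy i ik.
by apply: xy; rewrite ltn_double.
Qed.

Lemma cts_od F : cts F -> cts (fun u => od (F u)).
Proof.
apply: cts_comp => x k; exists k.*2 => y xy i ik.
by apply: xy; rewrite ltn_Sdouble.
Qed.

Lemma cts_jn F G : cts F -> cts G -> cts (fun u => jn (F u) (G u)).
Proof.
move=> cF cG x k; have [m mP] := cF x k; have [l lP] := cG x k.
exists (maxn m l) => y xy i ik; have ik2 : i./2 < k.
  by apply: leq_ltn_trans ik; rewrite -divn2 leq_div.
rewrite /jn; case: ifP => _.
  by apply: lP ik2; apply: agree_le xy; rewrite leq_maxr.
by apply: mP ik2; apply: agree_le xy; rewrite leq_maxl.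
Qed.

Definition behd (u : N) : N := fun k => u k.+1.

Lemma cts_behd F : cts F -> cts (fun u => behd (F u)).
Proof. by apply: cts_comp => x k; exists k.+1 => y xy i ik; apply: xy. Qed.

Ltac ctac := repeat first [exact: cts_id | exact: (cts_ev cts_id)
  | exact: (cts_od cts_id) | apply: cts_jn | apply: cts_ev
  | apply: cts_od | apply: cts_behd].

Definition decode (c : nat) : seq nat := odflt [::] (unpickle c).

Lemma decodeK s : decode (pickle s) = s.
Proof. by rewrite /decode pickleK. Qed.

(* Strategies are reduced to functions of the opponent's moves only: player I
   answers [s] to the first [k] moves of II, player II answers [t] to the first
   [k.+1] moves of I. *)
Definition playI (s b : N) : N := fun k => s (pickle (mkseq b k)).
Definition playII (t a : N) : N := fun k => t (pickle (mkseq a k.+1)).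

(** The offset [d] is 0 for [playI] and 1 for [playII], where the answer has seen one more move.
    Coordinate [k] uses a prefix of [G u] and a single value of [F u]. *)
Lemma cts_strat (d : nat) F G : cts F -> cts G ->
  cts (fun u k => F u (pickle (mkseq (G u) (d + k)))).
Proof.
move=> cF cG; apply: cts_pointwise => x k.
have [m mP] := cG x (d + k).
have [l lP] := cF x (pickle (mkseq (G x) (d + k))).+1.
exists (maxn m l) => y xy.
rewrite -(@agree_mkseq (d + k) (G x) (G y)); last first.
  by apply: mP; apply: agree_le xy; rewrite leq_maxl.
by apply: (lP y) => //; apply: agree_le xy; rewrite leq_maxr.
Qed.

Lemma cts_playI F G : cts F -> cts G -> cts (fun u => playI (F u) (G u)).
Proof. exact: (@cts_strat 0). Qed.

Lemma cts_playII F G : cts F -> cts G -> cts (fun u => playII (F u) (G u)).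
Proof. exact: (@cts_strat 1). Qed.

Definition copen (A : set N) :=
  forall x, A x -> exists m, forall y, agree m x y -> A y.

(* Unlike [Sigma1], the hierarchy starts at 0, with the open sets. *)
Fixpoint Sig (m : nat) (A : set N) : Prop :=
  if m is m'.+1 then
    exists2 B, Sig m' B & forall x, A x <-> exists b, ~ B (jn x b)
  else copen A.

Definition Pi (m : nat) (A : set N) := Sig m (fun x => ~ A x).

Lemma Sig_iff m A B : (forall x, A x <-> B x) -> Sig m A -> Sig m B.
Proof.
by move=> AB; rewrite (_ : A = B) //; apply/funext => x; apply/propext.
Qed.

Lemma Sig_notPi m A : Sig m A -> Pi m (fun x => ~ A x).
Proof. by apply: Sig_iff => x; rewrite notK. Qed.

Lemma Sig_pre m A F : cts F -> Sig m A -> Sig m (fun x => A (F x)).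
Proof.
elim: m A F => [|m IH] A F cF.
  move=> oA x /oA[k kP]; have [l lP] := cF x k.
  by exists l => y /lP /kP.
move=> [B SB AB]; exists (fun u => B (jn (F (ev u)) (od u))).
  apply: (IH B (fun u => jn (F (ev u)) (od u))) => //.
  by apply: cts_jn; [apply: (cts_comp cF)|]; ctac.
by move=> x; rewrite AB; split=> -[b bP]; exists b; move: bP; rewrite evE odE.
Qed.

Lemma Sig_ex m A : Sig m A -> Sig m (fun x => exists b, A (jn x b)).
Proof.
case: m => [|m].
  move=> oA x [b /oA[k kP]]; exists k => y xy; exists b; apply: kP => i ik.
  by rewrite /jn; case: ifP => // _; apply: xy; apply: leq_ltn_trans ik;
    rewrite -divn2 leq_div.
move=> [B SB AB].
exists (fun u => B (jn (jn (ev u) (ev (od u))) (od (od u)))).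
  apply: (@Sig_pre _ B (fun u => jn (jn (ev u) (ev (od u))) (od (od u)))) => //.
  by ctac.
move=> x; split=> [[b /AB[c bc]]|[d]].
  by exists (jn b c); rewrite !(evE, odE).
by rewrite evE odE => dP; exists (ev d); apply/AB; exists (od d).
Qed.

Lemma Pi_Sig_dummy m A : Pi m A -> Sig m.+1 A.
Proof.
move=> PA; exists (fun u => ~ A (ev u)).
  by apply: (Sig_pre _ PA); ctac.
move=> x; split=> [Ax|[b]]; first by exists x; rewrite evE notK.
by rewrite evE notK.
Qed.

Lemma Sig_Pi_dummy m A : Sig m A -> Pi m.+1 A.
Proof. by move=> /Sig_notPi/Pi_Sig_dummy. Qed.

(** Storing the index in coordinate 0 merges a sequence of sets into one. Quantifying over a
    sequence that carries the index then yields countable unions. *)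
Lemma Sig_sum m (A : nat -> set N) : (forall n, Sig m (A n)) ->
  Sig m (fun u => A (u 0) (behd u)).
Proof.
elim: m A => [|m IH] A SA.
  move=> u /SA[k kP]; exists k.+1 => v uv; rewrite -(uv 0) //.
  by apply: kP => i ik; apply: uv.
have /choice[B BP] n : exists B, Sig m B /\
    forall x, A n x <-> exists b, ~ B (jn x b).
  by have [B SB AB] := SA n; exists B.
exists (fun u => B (u 0) (jn (behd (ev u)) (od u))).
  have /(IH) SBs n : Sig m (B n) by case: (BP n).
  have cF : cts (fun u k => if k is k'.+1 then jn (behd (ev u)) (od u) k'
                            else u 0).
    apply: cts_pointwise => x [|k]; first by exists 1 => y ->.
    have cG : cts (fun u => jn (behd (ev u)) (od u)).
      by ctac.
    by have [l lP] := cG x k.+1; exists l => y /lP /(_ k); apply.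
  exact: (Sig_pre cF SBs).
by move=> u; rewrite (BP _).2; split=> -[b bP]; exists b; move: bP;
  rewrite evE odE /jn.
Qed.

Lemma Sig_bigcup m (A : nat -> set N) : (forall n, Sig m (A n)) ->
  Sig m (fun x => exists n, A n x).
Proof.
move=> /Sig_sum SA.
have cF : cts (fun u k => if k is k'.+1 then ev u k' else od u 0).
  apply: cts_pointwise => x [|k]; first by exists 2 => y xy; exact: (xy 1).
  by exists k.*2.+1 => y xy; exact: (xy k.*2).
have := Sig_ex (Sig_pre cF SA); apply: Sig_iff => x; split=> [[b]|[n Anx]].
  by rewrite /behd !(evE, odE) => Ax; exists (b 0).
by exists (fun=> n); rewrite /behd !(evE, odE).
Qed.

Lemma Sig_or m A B : Sig m A -> Sig m B -> Sig m (fun x => A x \/ B x).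
Proof.
move=> SA SB.
have /Sig_bigcup : forall n, Sig m (if n is 0 then A else B) by case.
apply: Sig_iff => x; split=> [[[|n]]|[|]]; [by left|by right|..].
  by exists 0.
by exists 1.
Qed.

Lemma Sig_and m A B : Sig m A -> Sig m B -> Sig m (fun x => A x /\ B x).
Proof.
elim: m A B => [|m IH] A B.
  move=> oA oB x [/oA[k kP] /oB[l lP]]; exists (maxn k l) => y xy.
  by split; [apply: kP|apply: lP]; apply: agree_le xy;
    rewrite (leq_maxl, leq_maxr).
move=> [C SC AC] [D SD BD].
exists (fun u => C (jn (ev u) (ev (od u))) \/ D (jn (ev u) (od (od u)))).
  by apply: Sig_or; apply: Sig_pre => //;
  ctac.
move=> x; split=> [[/AC[b bP] /BD[c cP]]|[d /not_orP[]]].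
  by exists (jn b c); rewrite !(evE, odE) => -[].
by rewrite evE => nC nD; split; [apply/AC|apply/BD]; [exists (ev (od (jn x d)))
  |exists (od (od (jn x d)))].
Qed.

Lemma Sig_universal m : exists2 U, Sig m U &
  forall A, Sig m A -> exists z, forall x, A x <-> U (jn z x).
Proof.
elim: m => [|m [U SU UP]].
  exists (fun u => exists k, ev u (pickle (mkseq (od u) k)) != 0).
    apply: Sig_bigcup => k; move=> x kx.
    have cF : cts (fun u k => ev u (pickle (mkseq (od u) (0 + k)))).
      by apply: cts_strat; ctac.
    have [m mP] := cF x k.+1; exists m => y /mP /(_ k).
    by rewrite ltnSn add0n => <-.
  (* The parameter marks the codes of the finite sequences all of whose extensions lie in [A]. *)
  move=> A oA; exists (fun c => 
    `[< exists2 s, unpickle c = Some s &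
        forall y, mkseq y (size s) = s -> A y >] : nat) => x.
  rewrite evE odE; split=> [/oA[k kP]|[k]].
    exists k; rewrite eqb0 negbK; apply/asboolP; exists (mkseq x k).
      by rewrite pickleK.
    by move=> y; rewrite size_mkseq => /mkseq_agree/agree_sym /kP.
  rewrite eqb0 negbK => /asboolP[s]; rewrite pickleK => -[<-].
  by apply; rewrite size_mkseq.
exists (fun u => exists b, ~ U (jn (ev u) (jn (od u) b))).
  exists (fun u => U (jn (ev (ev u)) (jn (od (ev u)) (od u)))).
    apply: (Sig_pre _ SU).
    by ctac.
  by move=> u; split=> -[b bP]; exists b; move: bP; rewrite ?(evE, odE).
move=> A [B /UP[z zB] AB]; exists z => x; rewrite AB evE odE.
by split=> -[b bP]; exists b; apply: contra_not bP => /zB.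
Qed.

(** * Prewellorderings from determinacy *)

Definition sdetermined (A : set N) :=
  (exists s, forall b, A (jn (playI s b) b)) \/
  (exists t, forall a, ~ A (jn a (playII t a))).

Section Diagonal.
Variables (K : Type) (nxt : K -> K) (s t : K -> N).

(** All boards [i : K] advance together: [diag k i] holds the first [k] moves of both sides on board
    [i]. Move [k] of [b i] needs only [k.+1] moves of [a (nxt i)], so recursion on [k] works for any
    [nxt], well-founded or not. *)
Fixpoint diag (k : nat) : K -> seq nat * seq nat :=
  if k is k'.+1 then fun i =>
    let a j := rcons (diag k' j).1 (s j (pickle (diag k' j).2)) in
    (a i, rcons (diag k' i).2 (t i (pickle (a (nxt i)))))
  else fun=> ([::], [::]).

Lemma diagonal_play : exists a b : K -> N,
  (forall i, a i = playI (s i) (b i)) /\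
  (forall i, b i = playII (t i) (a (nxt i))).
Proof.
pose a i : N := fun k => s i (pickle (diag k i).2).
pose b i : N := fun k => t i (pickle (diag k.+1 (nxt i)).1).
have ab k i : diag k i = (mkseq (a i) k, mkseq (b i) k).
  by elim: k i => [|k IH] i //=; rewrite !IH !mkseqS /a /b /= !IH.
by exists a, b; split=> i; apply/funext => k; rewrite /a /b ab.
Qed.
End Diagonal.

Lemma play_against s t : exists a b, a = playI s b /\ b = playII t a.
Proof.
have [a [b [aE bE]]] := @diagonal_play unit id (fun=> s) (fun=> t).
by exists (a tt), (b tt); rewrite -aE -bE.
Qed.

(** Player II can disregard the last move of I, and so use a strategy meant for I. *)
Lemma playI_as_II s : exists t, forall b, playII t b = playI s b.
Proof.
exists (fun c => let w := decode c in
  s (pickle (take (size w).-1 w))) => b.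
apply/funext => k; rewrite /playII /playI decodeK size_mkseq /=.
by rewrite mkseqS -cats1 take_size_cat // size_mkseq.
Qed.

(* [L x y] stands for "rank x <= rank y" and [S x y] for "rank x < rank y", for
   [x] in [P], all points outside [P] having rank infinity. *)
Record prewellord (P : set N) (L S : N -> N -> Prop) : Prop := Prewellord {
  pwo_disj : forall x y, S y x -> ~ L x y;
  pwo_cover : forall x y, P x \/ P y -> L x y \/ S y x;
  pwo_domL : forall x y, L x y -> P x;
  pwo_domS : forall x y, S x y -> P x;
  pwo_weak : forall x y, S x y -> L x y;
  pwo_wf : forall u v : nat -> N,
    (forall i, S (v i) (u i)) -> (forall i, L (u i.+1) (v i)) -> False }.

Definition rel2 (C : set (set N)) (R : N -> N -> Prop) :=
  C (fun u => R (ev u) (od u)).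

(** This is the prewellordering property of [C]. *)
Definition pwo_class (C : set (set N)) := forall P, C P ->
  exists L S, [/\ rel2 C L, rel2 C S & prewellord P L S].

(** The rank of a point is the least [k] such that its first [k] values already force membership in
    [P]. *)
Lemma pwo_open : pwo_class (Sig 0).
Proof.
move=> P oP; pose St k x := forall y, agree k x y -> P y.
have StP k x : St k x -> P x by apply.
have Stle k l x : k <= l -> St k x -> St l x.
  by move=> kl kx y xy; apply: kx; apply: agree_le xy.
have Stloc k x y : agree k x y -> St k x -> St k y.
  by move=> xy kx z yz; apply: kx; apply: agree_trans yz.
have oSt2 k l (u v : N) : agree (maxn k l).*2 u v ->
    (St k (ev u) -> St k (ev v)) /\ (St l (od v) -> St l (od u)).
  move=> uv; split; apply: Stloc => i ik.
    by apply: uv; rewrite ltn_double; apply: leq_trans ik _; rewrite leq_maxl.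
  apply/esym/uv; rewrite ltn_Sdouble; apply: leq_trans ik _.
  by rewrite leq_maxr.
exists (fun x y => exists k, St k x /\ forall j, j < k -> ~ St j y).
exists (fun x y => exists k, St k x /\ ~ St k y).
split.
- move=> u [k [kx ky]]; exists k.*2 => v uv; exists k; split.
    by apply: (oSt2 k k u v _).1 kx; rewrite maxnn.
  move=> j jk; apply: contra_not (ky j jk); apply: (oSt2 k j u v _).2.
  by rewrite (maxn_idPl (ltnW jk)).
- move=> u [k [kx ky]]; exists k.*2 => v uv; exists k; split.
    by apply: (oSt2 k k u v _).1 kx; rewrite maxnn.
  by apply: contra_not ky; apply: (oSt2 k k u v _).2; rewrite maxnn.
split.
- move=> x y [k [ky kx]] [l [lx ly]].
  have [lk|/ly//] := leqP l k.
  by apply: kx; apply: Stle lx.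
- move=> x y PP.
  have [[k kP]|/forallNP nS] := pselect (exists k, St k y /\ ~ St k x).
    by right; exists k.
  have yx k : St k y -> St k x.
    by move=> ky; apply: contrapT => kx; apply: (nS k).
  have [k kx] : exists k, St k x.
    by case: PP => [/oP[k kx]|/oP[k ky]]; exists k => //; apply: yx.
  have ex : exists k, `[< St k x >] by exists k; apply/asboolP.
  left; case: (ex_minnP ex) => l /asboolP lx lmin.
  exists l; split => // j jl /yx jx.
  by have := lmin j (asboolT jx); rewrite leqNgt jl.
- by move=> x y [k [/StP]].
- by move=> x y [k [/StP]].
- move=> x y [k [kx ky]]; exists k; split => // j jk /(Stle _ _ _ (ltnW jk)).
  exact: ky.
- move=> u v Sv Lu.
  have {}/choice[k kP] i : exists k, St k (v i) /\ ~ St k (u i) by apply: Sv.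
  have dec i : k i.+1 < k i.
    have [l [lu lv]] := Lu i; rewrite ltnNge; apply/negP => kk.
    apply: (kP i.+1).2; apply: Stle lu; apply: leq_trans kk.
    by rewrite leqNgt; apply/negP => /lv; apply; apply: (kP i).1.
  have bnd i : k i + i <= k 0.
    elim: i => [|i]; rewrite ?addn0 // addnS; apply: leq_trans.
    by rewrite -addSn leq_add2r.
  by have := leq_trans (leq_addl _ _) (bnd (k 0).+1); rewrite ltnn.
Qed.

(** * Transfer of the prewellordering property along real quantifiers *)

Section Periodicity.
Hypothesis det : forall m A, Sig m A -> sdetermined A.

(* Moschovakis's first periodicity: the elements of a universally quantified set
   are compared by a game in which I attacks the membership of one of them, and
   II that of the other. *)
Lemma pwo_Pi m : pwo_class (Sig m) -> pwo_class (Pi m.+1).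
Proof.
move=> pS P [B SB PB].
have {}PB x : P x <-> forall b, B (jn x b).
  split=> [Px b|Bx]; apply: contrapT.
    by move=> nB; have /PB : exists b, ~ B (jn x b) by exists b.
  by move=> /PB[b]; apply; apply: Bx.
have [L1 [S1 [cL cS [disj cov dL dS wk wf]]]] := pS B SB.
(* I plays the sequence paired with [x], II the one paired with [y]. Each relation says that one
   player has no winning strategy, which has the form required for [Pi m.+1]; determinacy converts
   this into a winning strategy of the other player in [winS] and [winL]. *)
pose L x y := forall s, exists b, L1 (jn x (playI s b)) (jn y b).
pose S y x := forall t, exists a, S1 (jn y (playII t a)) (jn x a).
have winS y x : S y x -> exists s, forall b, S1 (jn y b) (jn x (playI s b)).
  move=> Syx.
  pose F u := jn (jn y (od u)) (jn x (ev u)).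
  have cF : cts F by apply: cts_jn; apply: cts_jn; ctac; apply: cts_cst.
  have [[s sP]|[t tP]] := det (Sig_pre cF cS).
    by exists s => b; have := sP b; rewrite /F !(evE, odE).
  by have [a] := Syx t; have := tP a; rewrite /F !(evE, odE).
have winL x y : L x y -> exists t, forall a, L1 (jn x a) (jn y (playII t a)).
  move=> Lxy.
  pose F u := jn (jn x (ev u)) (jn y (od u)).
  have cF : cts F by apply: cts_jn; apply: cts_jn; ctac; apply: cts_cst.
  (* The payoff set for I is now a complement, in [Pi m], so determinacy is applied one level
     higher. *)
  have [[s sP]|[t tP]] := det (Pi_Sig_dummy (Sig_notPi (Sig_pre cF cL))).
    by have [b] := Lxy s; have := sP b; rewrite /F !(evE, odE).
  by exists t => a; have := tP a; rewrite /F !(evE, odE) notK.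
exists L, S; split.
- exists (fun u => exists b,
    L1 (jn (ev (ev u)) (playI (od u) b)) (jn (od (ev u)) b)).
    pose F u := jn (jn (ev (ev (ev u))) (playI (od (ev u)) (od u)))
                   (jn (od (ev (ev u))) (od u)).
    have cF : cts F.
      by apply: cts_jn; apply: cts_jn; ctac; apply: cts_playI; ctac.
    apply: Sig_iff (Sig_ex (Sig_pre cF cL)) => u.
    by split=> -[b bP]; exists b; move: bP; rewrite /F !(evE, odE).
  move=> u; rewrite /L; split=> [/existsNP[s sP]|[s sP]].
    by exists s; move: sP; rewrite evE odE.
  by move=> /(_ s); move: sP; rewrite evE odE.
- exists (fun u => exists a,
    S1 (jn (ev (ev u)) (playII (od u) a)) (jn (od (ev u)) a)).
    pose F u := jn (jn (ev (ev (ev u))) (playII (od (ev u)) (od u)))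
                   (jn (od (ev (ev u))) (od u)).
    have cF : cts F.
      by apply: cts_jn; apply: cts_jn; ctac; apply: cts_playII; ctac.
    apply: Sig_iff (Sig_ex (Sig_pre cF cS)) => u.
    by split=> -[b bP]; exists b; move: bP; rewrite /F !(evE, odE).
  move=> u; rewrite /S; split=> [/existsNP[s sP]|[s sP]].
    by exists s; move: sP; rewrite evE odE.
  by move=> /(_ s); move: sP; rewrite evE odE.
split.
- move=> x y /winS[s sP] /(_ s)[b]; exact: disj.
- move=> x y Pxy.
  have cov1 a b : L1 (jn x a) (jn y b) \/ S1 (jn y b) (jn x a).
    by apply: cov; case: Pxy => /PB; [left|right].
  have [Syx|/existsNP[t tP]] := pselect (S y x); [by right|left=> s].
  have [a [b [aE bE]]] := play_against s t.
  exists b; rewrite -aE; case: (cov1 a b) => // Sba.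
  by case: tP; exists a; rewrite -bE.
- move=> x y Lxy; apply/PB => a.
  (* I ignores the answers and plays out [a], reading the round off the length of the position. For
     II, in the next item, [.-1] accounts for the additional move seen. *)
  have [b] := Lxy (fun c => a (size (decode c))).
  rewrite (_ : playI _ b = a); first exact: dL.
  by apply/funext => k; rewrite /playI decodeK size_mkseq.
- move=> y x Syx; apply/PB => b.
  have [a] := Syx (fun c => b (size (decode c)).-1).
  rewrite (_ : playII _ a = b); first exact: dS.
  by apply/funext => k; rewrite /playII decodeK size_mkseq.
(* The sequence paired with [x] is played by I in [S y x] but by II in [L y x], so [s] has to change
   seats before it meets [s']. *)
- move=> y x /winS[s sP] s'; have [t tE] := playI_as_II s.
  have [b [a [bE aE]]] := play_against s' t.
  by exists a; rewrite -bE; apply: wk; rewrite aE tE.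
- move=> u v Svu Luv.
  have /choice[s sP] i := winS _ _ (Svu i).
  have /choice[t tP] i := winL _ _ (Luv i).
  (* Infinitely many games run at once: [s i] plays [a i] for [u i] against [b i], and [t i] plays
     [b i] for [v i] against [a i.+1]. The resulting plays descend forever in the relations of
     [B]. *)
  have [a [b [aE bE]]] := diagonal_play succn s t.
  apply: (wf (fun i => jn (u i) (a i)) (fun i => jn (v i) (b i))) => i.
    by rewrite aE.
  by rewrite bE.
Qed.

(** The rank of [x] is the least rank of a pair [jn x a]: [E R] asks for one [a] that compares well
    with every [b]. *)
Lemma pwo_Sig m : pwo_class (Pi m) -> pwo_class (Sig m.+1).
Proof.
move=> pP P [B SB PB].
have [L1 [S1 [cL cS [disj cov dL dS wk wf]]]] := pP _ (Sig_notPi SB).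
pose E (R : N -> N -> Prop) x y := exists a, forall b, R (jn x a) (jn y b).
have cE R : rel2 (Pi m) R -> rel2 (Sig m.+1) (E R).
  move=> cR; exists (fun u => exists b,
     ~ R (jn (ev (ev u)) (od u)) (jn (od (ev u)) b)).
    pose F u := jn (jn (ev (ev (ev u))) (od (ev u)))
                   (jn (od (ev (ev u))) (od u)).
    have cF : cts F by rewrite /F; ctac.
    apply: Sig_iff (Sig_ex (Sig_pre cF cR)) => u.
    by split=> -[b bP]; exists b; move: bP; rewrite /F !(evE, odE).
  move=> u; split=> -[a aP]; exists a.
    by rewrite evE odE => -[b]; apply; apply: aP.
  by move=> b; apply: contrapT => nR; apply: aP; exists b; rewrite evE odE.
exists (E L1), (E S1); split; [exact: cE|exact: cE|split].
- by move=> x y [b bP] [a /(_ b)]; apply: disj.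
- move=> x y Pxy; apply: contrapT => /not_orP[/forallNP nL /forallNP nS].
  have {}/choice[f fP] a : exists b, ~ L1 (jn x a) (jn y b).
    by apply/existsNP.
  have {}/choice[g gP] b : exists a, ~ S1 (jn y b) (jn x a).
    by apply/existsNP.
  (* If both comparisons fail, x and y answer each other forever. *)
  have Sf a : ~ B (jn x a) -> S1 (jn y (f a)) (jn x a).
    by move=> Ba; have [/fP|] := cov _ _ (or_introl Ba : _ \/ ~ B (jn y (f a))).
  have Lg b : ~ B (jn y b) -> L1 (jn x (g b)) (jn y b).
    by move=> Bb; have [|/gP] := cov _ _ (or_intror Bb : ~ B (jn x (g b)) \/ _).
  have [a0 Ba0] : exists a, ~ B (jn x a).
    case: Pxy => /PB[c Bc]; first by exists c.
    by exists (g c); apply: dL (Lg _ Bc).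
  pose a i := iter i (g \o f) a0.
  have Ba i : ~ B (jn x (a i)).
    by elim: i => // i /Sf/dS/Lg/dL.
  apply: (wf (fun i => jn x (a i)) (fun i => jn y (f (a i)))) => i.
    exact: Sf.
  exact/Lg/dS/Sf.
- by move=> x y [a aP]; apply/PB; exists a; apply: dL (aP a).
- by move=> x y [a aP]; apply/PB; exists a; apply: dS (aP a).
- by move=> x y [a aP]; exists a => b; apply: wk.
- move=> u v Svu Luv.
  have /choice[b bP] i := Svu i.
  have /choice[a aP] i := Luv i.
  (* Nothing lies above [u 0], so [b 0] is an arbitrary filler there; [bP] compares with every
     sequence. *)
  apply: (wf (fun i => jn (u i) (if i is j.+1 then a j else b 0))
             (fun i => jn (v i) (b i))) => i.
    exact: bP.
  exact: aP.
Qed.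

Lemma pwo_Pi_odd n : pwo_class (Pi n.*2.+1).
Proof.
elim: n => [|n IH]; first exact: (pwo_Pi pwo_open).
by rewrite doubleS; apply/pwo_Pi/pwo_Sig.
Qed.
End Periodicity.

(** * Ideals from a universal set *)

Definition supp (x : N) : set nat := [set k | x k != 0].
Definition indic (s : set nat) : N := fun k => `[< s k >].

Lemma supp_indic s : supp (indic s) = s.
Proof.
by apply/predeqP => k; rewrite /supp /indic /= eqb0 negbK; split=> /asboolP.
Qed.

Lemma copen_at F (k : nat) (p : nat -> Prop) :
  cts F -> copen (fun x => p (F x k)).
Proof.
by move=> cF x px; have [m mP] := cF x k.+1; exists m => y /mP <-.
Qed.

Lemma Sig_odd_closed n A : Pi 0 A -> Sig n.*2.+1 A.
Proof.
move=> /Pi_Sig_dummy cA; elim: n => [//|n IH].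
by rewrite doubleS; apply/Pi_Sig_dummy/Sig_Pi_dummy.
Qed.

(** Every fibre of [logn 2] is infinite, which supplies infinitely many nodes of a branch for each
    number. *)
Lemma logn2_fiber n j : logn 2 (2 ^ n * j.*2.+1) = n.
Proof.
rewrite lognM ?expn_gt0 // pfactorK // lognE /= dvdn2 /= odd_double.
by rewrite /= addn0.
Qed.

Section Ideals.
Variables (m : nat) (U : set N) (L S : N -> N -> Prop).
Hypothesis Sclosed : forall A, Pi 0 A -> Sig m A.
(** [U] is kept on the Sigma side: the sections to be turned into ideals are those of its
    complement, on which [S] compares ranks. *)
Hypothesis SU : Sig m U.
Hypothesis cS : rel2 (Pi m) S.
Hypothesis pwoS : prewellord (fun u => ~ U u) L S.

Let Sirr x : ~ S x x.
Proof.
by move=> Sxx; apply: (pwo_wf pwoS (u := fun=> x) (v := fun=> x)) => // i;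
  apply: pwo_weak pwoS _ _ _.
Qed.

Let Sasym x y : S x y -> ~ S y x.
Proof.
move=> Sxy Syx.
by apply: (pwo_wf pwoS (u := fun=> x) (v := fun=> y)) => // i;
  apply: pwo_weak pwoS _ _ _.
Qed.

Let Sout x y : ~ U x -> U y -> S x y.
Proof.
move=> Ux Uy; have [/(pwo_domL pwoS)//|//] : L y x \/ S x y.
by apply: (pwo_cover pwoS); right.
Qed.

(** Expressing the rank bound by [~ S], with [S] in [Pi m], keeps the existence of a chain in
    [Sig m]. *)
Definition covered z x x' := exists y y',
  [/\ ~ S (jn z x) (jn z y), ~ S (jn z x) (jn z y')
    & supp x' `<=` supp y `|` supp y'].

Fixpoint bad_in (n : nat) (z x : N) : Prop :=
  if n is n'.+1 then exists x', covered z x x' /\ bad_in n' z x'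
  else U (jn z x).

Definition good z x := forall n, ~ bad_in n z x.

Lemma good_notU z x : good z x -> ~ U (jn z x).
Proof. by move=> /(_ 0). Qed.

Lemma good_covered z x x' : good z x -> covered z x x' -> good z x'.
Proof. by move=> gx xx' n bx'; apply: (gx n.+1); exists x'. Qed.

(** Whichever of [x] and [y] has the larger rank covers [w] in one link. Allowing an inclusion gives
    closure under subsets as well. *)
Lemma good_union z x y w :
  good z x -> good z y -> supp w `<=` supp x `|` supp y -> good z w.
Proof.
move=> gx gy wxy; have [Syx|nSyx] := pselect (S (jn z y) (jn z x)).
  apply: (good_covered gx); exists x, y; split => //; exact: Sasym.
by apply: (good_covered gy); exists x, y; split => //.
Qed.

(** By [Sout], a set not ranked above a member is itself a member. If the section is an ideal, every
    link of a chain therefore stays inside it. *)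
Lemma good_ideal z : (forall x y w, ~ U (jn z x) -> ~ U (jn z y) ->
    supp w `<=` supp x `|` supp y -> ~ U (jn z w)) ->
  forall x, good z x <-> ~ U (jn z x).
Proof.
move=> iU x; split=> [/good_notU//|Ux n]; elim: n x Ux => //= n IH x Ux.
move=> [x' [[y [y' [nSy nSy' x'y]]]]]; apply: IH.
by apply: iU x'y => [Uy|Uy']; [apply: nSy|apply: nSy']; apply: Sout.
Qed.

Lemma Sig_bad : Sig m (fun u => ~ good (ev u) (od u)).
Proof.
have Sbad n : Sig m (fun u => bad_in n (ev u) (od u)).
  elim: n => [|n IH]; first by apply: Sig_iff SU => u; rewrite /= jnK.
  (* One real packs the next point of the chain with the two sets that cover it. *)
  pose zx (v : N) := ev v.
  pose x' v := ev (od v); pose y v := ev (od (od v)).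
  pose y' v := od (od (od v)).
  pose Q v := ~ S (zx v) (jn (ev (zx v)) (y v)) /\
    (~ S (zx v) (jn (ev (zx v)) (y' v)) /\
    (supp (x' v) `<=` supp (y v) `|` supp (y' v) /\
     bad_in n (ev (zx v)) (x' v))).
  have SQ : Sig m Q.
    apply: Sig_and; [|apply: Sig_and; [|apply: Sig_and]].
    - apply: Sig_iff (Sig_pre
        (F := fun v => jn (zx v) (jn (ev (zx v)) (y v))) _ cS).
        by move=> v; rewrite evE odE.
      by rewrite /zx /y; ctac.
    - apply: Sig_iff (Sig_pre
        (F := fun v => jn (zx v) (jn (ev (zx v)) (y' v))) _ cS).
        by move=> v; rewrite evE odE.
      by rewrite /zx /y'; ctac.
    - apply: Sclosed.
      have op : Sig 0 (fun v => exists k, x' v k != 0 /\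
          ((y v k == 0) /\ (y' v k == 0))).
        apply: Sig_bigcup => k; apply: Sig_and; [|apply: Sig_and].
        + by apply: (@copen_at x' k (fun i => i != 0)); rewrite /x'; ctac.
        + by apply: (@copen_at y k (fun i => i == 0)); rewrite /y; ctac.
        + by apply: (@copen_at y' k (fun i => i == 0)); rewrite /y'; ctac.
      apply: Sig_iff op => v; split=> [[k [xk [/eqP yk /eqP yk']]]|].
        by move=> /(_ k xk)[|]; rewrite /supp /= (yk, yk').
      move=> /existsNP[k /not_implyP[xk /not_orP[yk yk']]]; exists k.
      by split=> //; split; apply/negPn/negP.
    - apply: Sig_iff (Sig_pre (F := fun v => jn (ev (zx v)) (x' v)) _ IH).
        by move=> v; rewrite evE odE.
      by rewrite /zx /x'; ctac.
  apply: Sig_iff (Sig_ex SQ) => u; split=> [[w]|[w [[w1 [w2 [a b c]]] d]]].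
    rewrite /Q /zx /x' /y /y' !(evE, odE) => -[a [b [c d]]].
    exists (ev w); split=> //; exists (ev (od w)), (od (od w)).
    by rewrite jnK.
  exists (jn w (jn w1 w2)); rewrite /Q /zx /x' /y /y' !(evE, odE).
  by rewrite jnK in a b.
apply: Sig_iff (Sig_bigcup Sbad) => u.
by split=> [[n bn] /(_ n)//|/existsNP[n /contrapT bn]]; exists n.
Qed.

(* The members of [s] are read as codes of finite sequences; the level of the
   restriction of the branch [z] to [k] is [logn 2 k], so that every level is
   met infinitely often along each branch. *)
Definition inf_levels (s : set nat) (z : N) : set nat :=
  [set n | forall j, exists k,
     [/\ j <= k, logn 2 k = n & s (pickle (mkseq z k))]].

(** The guard [supp x !=set0] keeps [set0] in the family even if some [z] has no good points at all.
    Ranging over all [x] below [inf_levels] makes closure under subsets immediate. *)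
Definition branch_ideal (s : set nat) := forall z x,
  supp x !=set0 -> supp x `<=` inf_levels s z -> good z x.

Lemma inf_levelsU s t z :
  inf_levels (s `|` t) z `<=` inf_levels s z `|` inf_levels t z.
Proof.
move=> n st; apply: contrapT => /not_orP[/existsNP[i nS] /existsNP[j nT]].
have [k [ijk kn [sk|tk]]] := st (maxn i j).
  by apply: nS; exists k; split => //; apply: leq_trans ijk; rewrite leq_maxl.
by apply: nT; exists k; split => //; apply: leq_trans ijk; rewrite leq_maxr.
Qed.

Lemma inf_levelsS s t z : s `<=` t -> inf_levels s z `<=` inf_levels t z.
Proof.
by move=> st n sn j; have [k [jk kn /st sk]] := sn j; exists k.
Qed.

Lemma branch_ideal_sub s t : t `<=` s -> branch_ideal s -> branch_ideal t.
Proof.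
move=> ts Js z x x0 xt; apply: Js => //.
exact: subset_trans xt (inf_levelsS ts).
Qed.

Lemma branch_ideal0 : branch_ideal set0.
Proof. by move=> z x [n xn] /(_ n xn 0)[k []]. Qed.

Lemma branch_idealU s t :
  branch_ideal s -> branch_ideal t -> branch_ideal (s `|` t).
Proof.
move=> Js Jt z x x0 xst.
pose x1 := supp x `&` inf_levels s z; pose x2 := supp x `&` inf_levels t z.
have xU : supp x `<=` x1 `|` x2.
  by move=> k xk; have [] := inf_levelsU (xst k xk); [left|right].
have g1 : x1 !=set0 -> good z (indic x1).
  by move=> ?; apply: Js; rewrite supp_indic // => k [].
have g2 : x2 !=set0 -> good z (indic x2).
  by move=> ?; apply: Jt; rewrite supp_indic // => k [].
(* Because of the guard, nothing is known about an empty part; [x] then lies in the other part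
   alone. *)
have [e1|/set0P n1] := eqVneq x1 set0.
  rewrite e1 set0U in xU; have gx2 : good z (indic x2).
    by apply: g2; case: x0 => k /xU; exists k.
  by apply: (good_union gx2 gx2); rewrite supp_indic setUid.
have [e2|/set0P n2] := eqVneq x2 set0.
  rewrite e2 setU0 in xU; have gx1 := g1 n1.
  by apply: (good_union gx1 gx1); rewrite supp_indic setUid.
by apply: (good_union (g1 n1) (g2 n2)); rewrite !supp_indic.
Qed.

(** A counterexample is a triple of [z], [x] and a Skolem function [g] choosing a node for each
    level and bound. With [g] given, the inclusion in [inf_levels] is a closed condition. *)
Lemma Pi_branch_ideal : Pi m (fun y => branch_ideal (supp y)).
Proof.
pose y (v : N) := ev v; pose z v := ev (od v).
pose x v := ev (od (od v)); pose g v := od (od (od v)).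
have cy : cts y by rewrite /y; ctac.
have cz : cts z by rewrite /z; ctac.
have cx : cts x by rewrite /x; ctac.
have cg : cts g by rewrite /g; ctac.
(* [playI] serves here only to evaluate [y] at the code of the restriction of [z] to [k]. *)
pose lvl v n j k :=
  [/\ j <= k, logn 2 k = n & playI (y v) (z v) k != 0].
pose Q v := (exists i, x v i != 0) /\
   ((forall n j, x v n != 0 -> lvl v n j (g v (pickle (n, j)))) /\
    ~ good (z v) (x v)).
have SQ : Sig m Q.
  apply: Sig_and; [|apply: Sig_and].
  - apply: Sig_bigcup => i; apply: Sclosed.
    exact: (@copen_at x i (fun c => ~ (c != 0))).
  - apply: Sclosed.
    have op : Sig 0 (fun v => exists n j k, g v (pickle (n, j)) = k /\
        (x v n != 0 /\ ~ lvl v n j k)).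
      apply: Sig_bigcup => n; apply: Sig_bigcup => j; apply: Sig_bigcup => k.
      apply: Sig_and; [|apply: Sig_and].
      + exact: (@copen_at g _ (fun i => i = k)).
      + exact: (@copen_at x n (fun c => c != 0)).
      + apply: (@copen_at (fun v => playI (y v) (z v)) k (fun c =>
           ~ [/\ j <= k, logn 2 k = n & c != 0])).
        exact: cts_playI.
    apply: Sig_iff op => v; split=> [[n [j [k [<- [xn nl]]]]] /(_ n j xn)//|].
    move=> /existsNP[n /existsNP[j /not_implyP[xn nl]]].
    by exists n, j, (g v (pickle (n, j))).
  - apply: Sig_iff (Sig_pre (F := fun v => jn (z v) (x v)) _ Sig_bad).
      by move=> v; rewrite evE odE.
    exact: cts_jn.
apply: Sig_iff (Sig_ex SQ) => t; split=> [[w]|].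
  rewrite /Q /lvl /x /y /z /g !(evE, odE) => -[[i xi] [xl ng]] Jt.
  apply: ng; apply: Jt; first by exists i.
  by move=> n xn j; exists (od (od w) (pickle (n, j))); apply: xl.
move=> /existsNP[z0 /existsNP[x0 /not_implyP[[i xi] /not_implyP[xl ng]]]].
have /choice[g0 gP] (c : nat) : exists k, forall n j, c = pickle (n, j) ->
    x0 n != 0 -> [/\ j <= k, logn 2 k = n & playI t z0 k != 0].
  case E : (unpickle c : option (nat * nat)) => [[n j]|]; last first.
    by exists 0 => n j cE; rewrite cE pickleK in E.
  have [xn|/negP xn] := boolP (x0 n != 0); last first.
    by exists 0 => n' j' cE; rewrite cE pickleK in E; case: E => -> _.
  have [k kP] := xl n xn j; exists k => n' j' cE.
  by rewrite cE pickleK in E; case: E => -> ->.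
exists (jn z0 (jn x0 g0)); rewrite /Q /lvl /x /y /z /g !(evE, odE).
split; first by exists i.
by split => // n j xn; apply: gP.
Qed.
End Ideals.

(** * Comparison with the topological definitions *)

(** The agreement sets form a filter base converging to [x] in each coordinate, hence pointwise.
    Both Baire space and Cantor space are instances. *)
Lemma nbhs_ptws_agree (T : uniformType) (x : {ptws nat -> T}) V : nbhs x V ->
  exists m, forall y : nat -> T, (forall i, i < m -> x i = y i) -> V y.
Proof.
pose B m := [set y : {ptws nat -> T} | forall i, i < m -> x i = y i].
have FF : Filter (filter_from [set: nat] B).
  apply: filter_from_filter; first by exists 0.
  move=> i j _ _; exists (maxn i j) => // y xy.
  by split=> k kl; apply: xy; apply: leq_trans kl _;
    rewrite (leq_maxl, leq_maxr).
have : filter_from [set: nat] B --> x.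
  apply/(@pointwise_cvgP nat T _ x FF) => t W /nbhs_singleton Wx.
  by exists t.+1 => // y /= /(_ t (ltnSn t)) <-.
by move=> /[apply] -[m _ mV]; exists m.
Qed.

Lemma near_ptws_coord (T : discreteUniformType) (x : {ptws nat -> T}) i :
  \forall y \near x, y i = x i.
Proof.
exact: (@proj_continuous nat (fun=> T) i x [set x i] (discrete_set1 _)).
Qed.

Definition tcts (X : topologicalType) (g : X -> N) :=
  forall x i, \forall y \near x, g y i = g x i.

Lemma tcts_agree (X : topologicalType) (g : X -> N) x k :
  tcts g -> \forall y \near x, agree k (g x) (g y).
Proof.
move=> cg; elim: k => [|k IH]; first exact: nearW.
apply: filterS2 IH (cg x k) => y yk yk1 i.
by rewrite ltnS leq_eqVlt => /orP[/eqP->|/yk].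
Qed.

Lemma tcts_jn (X : topologicalType) (g : X -> N) : tcts g ->
  tcts (fun p : X * baire_space => jn (g p.1) p.2).
Proof.
move=> cg p i; rewrite /jn; case: (odd i).
  exact: (cvg_snd (near_ptws_coord (p.2 : baire_space) i./2)).
exact: (cvg_fst (cg p.1 i./2)).
Qed.

(** The space varies along the induction: each quantifier replaces [X] by [X * baire_space], and [g]
    by its interleaving with the new sequence. *)
Lemma Sig_Sigma1 m A (X : topologicalType) (g : X -> N) : tcts g ->
  Sig m.+1 A -> Sigma1 m.+1 [set x | A (g x)].
Proof.
elim: m A X g => [|m IH] A X g cg [B SB AB];
  exists [set p : X * baire_space | ~ B (jn (g p.1) p.2)].
- apply: (@open_closedC _ [set p : X * baire_space | B (jn (g p.1) p.2)]).
  rewrite openE => p /SB[k kP].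
  by apply: filterS (tcts_agree p k (tcts_jn cg)) => q /kP.
- apply/predeqP => x; split=> [/AB[b bP]|[[y b] /= bP <-]].
    by exists (x, b).
  by apply/AB; exists b.
- have := IH B _ _ (tcts_jn cg) SB.
  by congr Sigma1; apply/predeqP => p /=; rewrite notK.
- apply/predeqP => x; split=> [/AB[b bP]|[[y b] /= bP <-]].
    by exists (x, b).
  by apply/AB; exists b.
Qed.

Definition ctst (X : topologicalType) (r : N -> X) :=
  forall x V, nbhs (r x) V -> exists k, forall y, agree k x y -> V (r y).

Lemma ctst_pair (X : topologicalType) (r : N -> X) : ctst r ->
  ctst (fun u => (r (ev u), od u : baire_space)).
Proof.
move=> cr u V [[P Q] /= [rP uQ] PQ].
have [k kP] := cr _ _ rP; have [l lP] := nbhs_ptws_agree uQ.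
exists (maxn k l).*2 => v uv; apply: PQ; split=> /=.
  apply: kP => i ik; apply: uv; rewrite ltn_double.
  by apply: leq_trans ik _; rewrite leq_maxl.
apply: lP => i il; apply: uv; rewrite ltn_Sdouble.
by apply: leq_trans il _; rewrite leq_maxr.
Qed.

Lemma Sigma1_Sig m (X : topologicalType) (A : set X) (r : N -> X) : ctst r ->
  Sigma1 m.+1 A -> Sig m.+1 (fun x => A (r x)).
Proof.
elim: m X A r => [|m IH] X A r cr [B SB ->].
  exists (fun u => ~ B (r (ev u), od u : baire_space)).
    move=> u uB; apply: (@ctst_pair X r cr u (~` B)).
    by apply: open_nbhs_nbhs; split => //; apply: closed_openC.
  move=> x; split=> [[[y b] /= yB yE]|[b]].
    by exists b; rewrite evE odE notK -yE.
  by rewrite /= evE odE notK => xB; exists (r x, b).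
exists (fun u => (~` B) (r (ev u), od u : baire_space)).
  exact: (IH _ _ _ (ctst_pair cr) SB).
move=> x; split=> [[[y b] /= yB yE]|[b]].
  by exists b; rewrite /= evE odE notK -yE.
by rewrite /= evE odE notK => xB; exists (r x, b).
Qed.

(** I's own moves are determined by [s], so [pos] rebuilds the full position from the moves of
    II. *)
Lemma winning_I_play (A : set baire_space) s : winning_I A s ->
  exists s', forall b, A (jn (playI s' b) b).
Proof.
move=> sA; pose pos bs := foldl (fun p b => rcons (rcons p (s p)) b) [::] bs.
exists (fun c => s (pos (decode c))) => b.
set s' := (X in playI X b); apply: sA.
have s'E k : playI s' b k = s (pos (mkseq b k)) by rewrite /playI /s' decodeK.
have posE k : mkseq (jn (playI s' b) b) k.*2 = pos (mkseq b k).
  elim: k => // k IH; rewrite doubleS !mkseqS IH /pos foldl_rcons -/(pos _).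
  rewrite -s'E; congr (rcons (rcons _ _) _).
    by rewrite -[LHS]/(ev (jn (playI s' b) b) k) evE.
  by rewrite -[LHS]/(od (jn (playI s' b) b) k) odE.
move=> k ek; have kE : k = k./2.*2 by rewrite -[LHS]odd_double_half ek.
by rewrite kE posE -s'E -[LHS]/(ev (jn (playI s' b) b) k./2) evE.
Qed.

Lemma winning_II_play (A : set baire_space) t : winning_II A t ->
  exists t', forall a, ~ A (jn a (playII t' a)).
Proof.
move=> tA.
pose pos bs := foldl (fun p a => rcons (rcons p a) (t (rcons p a))) [::] bs.
(* The rebuilt position ends with II's reply; the default 0 does not occur, as I has already
   moved. *)
exists (fun c => last 0 (pos (decode c))) => a.
set t' := (X in playII X a); apply: tA.
have t'E k : playII t' a k = t (rcons (pos (mkseq a k)) (a k)).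
  rewrite /playII /t' decodeK mkseqS.
  by rewrite /pos foldl_rcons last_rcons.
have aE k : jn a (playII t' a) k.*2 = a k.
  by rewrite -[LHS]/(ev (jn a (playII t' a)) k) evE.
have bE k : jn a (playII t' a) k.*2.+1 = playII t' a k.
  by rewrite -[LHS]/(od (jn a (playII t' a)) k) odE.
have posE k : mkseq (jn a (playII t' a)) k.*2 = pos (mkseq a k).
  elim: k => // k IH; rewrite doubleS !mkseqS IH /pos foldl_rcons -/(pos _).
  by rewrite aE bE t'E.
move=> k ok; have kE : k = k./2.*2.+1 by rewrite -[LHS]odd_double_half ok.
by rewrite kE mkseqS posE aE bE t'E.
Qed.

Lemma PD_Sig (hPD : PD) m A : Sig m A -> sdetermined A.
Proof.
move=> SA; have [] : determined (A : set baire_space).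
(* Two dummy quantifiers lift [A], possibly just open, to an index where [Sig] and [Sigma1] can be
   compared. *)
- apply: hPD; exists m.+2.
  apply: (@Sig_Sigma1 m.+1 A _ (fun x : baire_space => x)).
    by move=> x i; exact: near_ptws_coord.
  exact/Pi_Sig_dummy/Sig_Pi_dummy.
- by move=> [s /winning_I_play]; left.
- by move=> [s /winning_II_play]; right.
Qed.

Lemma ctst_cantor : ctst (fun x => (fun k => x k != 0) : cantor_space).
Proof.
move=> x V /nbhs_ptws_agree[k kP]; exists k => y xy.
by apply: kP => i /xy ->.
Qed.

Lemma tcts_cantor : tcts (fun c : cantor_space => (fun k => c k : nat)).
Proof. by move=> c i; apply: filterS (near_ptws_coord c i) => d ->. Qed.

Lemma Pi1_char_family m I :
  Pi1 m.+1 (char_family I) <-> Pi m.+1 (fun x => I (supp x)).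
Proof.
split=> [/(Sigma1_Sig ctst_cantor)//|/(Sig_Sigma1 tcts_cantor)].
congr Sigma1; apply/predeqP => c; rewrite /char_family /=.
by rewrite (_ : supp _ = [set k | c k = true]) //; apply/predeqP => k;
  rewrite /supp /= eqb0 negbK.
Qed.

(** * Reduction to the branch ideal and completeness *)

Lemma le_wRK_branch_ideal U S z (I : set (set nat)) : ideal I ->
  (forall x, good U S z x <-> I (supp x)) -> le_wRK I (branch_ideal U S).
Proof.
move=> [[s0 Is0] _ Isub] gI.
pose code k := pickle (mkseq z k).
pose level c := logn 2 (size (decode c)).
have levelE (w : N) k : level (pickle (mkseq w k)) = logn 2 k.
  by rewrite /level decodeK size_mkseq.
have mkseqE w k l : pickle (mkseq w k) = code l -> k = l /\ agree k w z.
  move=> /(pcan_inj (@pickleK (seq nat))) wz.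
  have kl : k = l by have := congr1 size wz; rewrite !size_mkseq.
  by split=> //; apply: mkseq_agree; rewrite wz kl.
(* The reduction lives on the nodes of the branch [z] and sends a node to the number that its level
   stands for. *)
exists (range code), level; split.
  have codeI : {in [set: nat] &, injective code} by move=> k l _ _ /mkseqE[].
  by rewrite (eq_finite_set (inj_card_eq codeI)); exact: infinite_nat.
move=> x; split=> [Ix w x' [n0 xn0] x'x|Jx].
  have wz : w = z.
    apply/funext => j.
    (* A node of length at least [j.+1] common to both branches forces them to agree at [j]. *)
    have [k [jk _ [[l _ /esym/mkseqE[_ wz]] _]]] := x'x _ xn0 j.+1.
    exact: wz.
  rewrite wz; apply/gI; apply: Isub Ix => n /x'x /(_ 0)[k [_ kn [_]]].
  by rewrite /= levelE kn.
(* The guard gives no information on the empty set, which lies in any ideal anyway. *)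
have [x0|/set0P x0] := eqVneq x set0; first by apply: Isub Is0; rewrite x0.
rewrite -(supp_indic x); apply/gI/Jx; rewrite supp_indic // => n xn j.
exists (2 ^ n * j.*2.+1); split; last split; last 1 first.
- by rewrite /= levelE logn2_fiber.
- rewrite -[leqLHS]mul1n leq_mul ?expn_gt0 //.
  by rewrite -addnn -addnS leq_addr.
- exact: logn2_fiber.
- by exists (2 ^ n * j.*2.+1).
Qed.

Theorem corollary1p5 (hPD : PD) (n : nat) :
  exists J, wRK_complete (Pi1_ideal (Nat.add (Nat.mul 2 n) 1)) J.
Proof.
have -> : Nat.add (Nat.mul 2 n) 1 = n.*2.+1.
  by rewrite -[LHS]/(2 * n + 1) mul2n addn1.
have [U SU univ] := Sig_universal n.*2.+1.
have [L [S [_ cS pwoS]]] := pwo_Pi_odd (@PD_Sig hPD) (Sig_notPi SU).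
exists (branch_ideal U S); split=> [|I [idI /Pi1_char_family PI]].
  split; last first.
    apply/Pi1_char_family.
    exact: (Pi_branch_ideal (@Sig_odd_closed n) SU cS).
  split; first by exists set0; apply: branch_ideal0.
    exact: (branch_idealU pwoS).
  exact: branch_ideal_sub.
(* The index [z] is that of the complement of [I], which is on the Sigma side. *)
have [z zP] := univ _ PI.
have {}zP x : I (supp x) <-> ~ U (jn z x).
  by split=> [Ix|Ux]; [move=> /zP|apply: contrapT => /zP].
apply: (le_wRK_branch_ideal (z := z)) => // x; rewrite zP.
apply: (good_ideal pwoS) => {}x y w /zP Ix /zP Iy wxy; apply/zP.
by case: idI => _ IU Isub; apply: Isub wxy _; apply: IU.
Qed.
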